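(* Let $G$ be a group, $I$ and $\Lambda$ nonempty sets, and $P=(p_{\lambda i})$ a $\Lambda\times I$ matrix with entries in $G$ that is normalized, i.e. contains a row and a column in which all the entries are $1$. Let $\mathcal{M}(G;I,\Lambda;P)$ be the corresponding completely simple Rees matrix semigroup, and let $H$ be the subgroup of $G$ generated by $[G,G]$ and the entries of $P$. Then for all $(i,s,\lambda),(j,t,\mu)\in\mathcal{M}(G;I,\Lambda;P)$, we have $(i,s,\lambda)\sim_s(j,t,\mu)$ if and only if $st^{-1}\in H$.
   Context: $\mathcal{M}(G;I,\Lambda;P)$ is the semigroup $I\times G\times\Lambda$ with multiplication $(i,s,\lambda)(j,t,\mu)=(i,sp_{\lambda j}t,\mu)$. $[G,G]$ is the commutator subgroup of $G$. For a semigroup $S$, $S^1$ denotes the monoid obtained by adjoining an identity element $1$ to $S$; if $S$ is already a monoid, $S^1=S$. For $s,t\in S$, $s\sim_s^1 t$ means there exist a positive integer $n$, elements $p_1,\dots,p_n\in S^1$, and a permutation $f$ of $\{1,\dots,n\}$ with $s=p_1\cdots p_n$ and $t=p_{f(1)}\cdots p_{f(n)}$; $\sim_s$ is the transitive closure of $\sim_s^1$. *)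

(* Defs.v *)
From HB Require Import structures.
From Stdlib Require Export Relation_Operators.
From mathcomp Require Export all_boot fingroup perm.
From mathcomp Require Export boolp classical_sets.

Set Implicit Arguments.
Unset Strict Implicit.
Unset Printing Implicit Defensive.

Local Open Scope classical_set_scope.
Local Open Scope group_scope.

(* The library's groupType and semigroupType carry a choice structure; this is
   no restriction, since boolp provides one classically on every type. *)

Section GeneratedSubgroup.
Variable G : groupType.
Implicit Types (A K : set G).

Definition gen_subgroup A : set G :=
  smallest [set K : set G | group_closed [in K]] A.

Definition commutator_subgroup : set G :=
  gen_subgroup [set [~ x, y] | x in [set: G] & y in [set: G]].

End GeneratedSubgroup.

Arguments commutator_subgroup : clear implicits.

Section AdjoinOne.
Variable S : semigroupType.

Definition has_identity : Prop :=
  exists e : S, left_id e *%g /\ right_id e *%g.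

Definition monoid_with (_ : has_identity) : Type := S.

Section AlreadyMonoid.
Variable h : has_identity.
HB.instance Definition _ := Semigroup.on (monoid_with h).
HB.instance Definition _ := Semigroup_isMonoid.Build (monoid_with h)
  (projT2 (cid h)).1 (projT2 (cid h)).2.
End AlreadyMonoid.

(* None is the new identity. *)
Definition adjoined : Type := option S.

Definition adjoined_mul (x y : adjoined) : adjoined :=
  match x, y with
  | None, _ => y
  | _, None => x
  | Some a, Some b => Some (a * b)
  end.

Lemma adjoined_mulA : associative adjoined_mul.
Proof. by move=> [a|] [b|] [c|] //=; rewrite mulgA. Qed.

Lemma adjoined_mul1 : left_id None adjoined_mul.
Proof. by case. Qed.

Lemma adjoined_mulr1 : right_id None adjoined_mul.
Proof. by case. Qed.

HB.instance Definition _ := Choice.on adjoined.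
HB.instance Definition _ := isMonoid.Build adjoined
  adjoined_mulA adjoined_mul1 adjoined_mulr1.

Definition S1 : monoidType :=
  match pselect has_identity with
  | left h => monoid_with h : monoidType
  | right _ => adjoined : monoidType
  end.

(* The inclusion of S into S^1, by the same case distinction as in S1. *)
Definition toS1 (s : S) : S1 :=
  match pselect has_identity as d return
    match d return monoidType with
    | left h => monoid_with h : monoidType
    | right _ => adjoined : monoidType
    end
  with
  | left _ => s
  | right _ => Some s
  end.

Definition sim_s1 (s t : S) : Prop :=
  exists (n : nat) (p : 'I_n -> S1) (f : 'S_n),
    [/\ (0 < n)%N, toS1 s = \prod_(k < n) p k
      & toS1 t = \prod_(k < n) p (f k)].

Definition sim_s : S -> S -> Prop := clos_trans S sim_s1.

End AdjoinOne.

Section Rees.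
Variables (G : groupType) (I Lam : Type).
Implicit Type P : Lam -> I -> G.

Definition normalized P : Prop :=
  (exists l, forall i, P l i = 1) /\ (exists i, forall l, P l i = 1).

Definition entries P : set G :=
  [set P l i | l in [set: Lam] & i in [set: I]].

Definition rees P : Type := (I * G * Lam)%type.

Definition rees_mul P (x y : rees P) : rees P :=
  let: (i, s, l) := x in let: (j, t, m) := y in (i, s * P l j * t, m).

Lemma rees_mulA P : associative (@rees_mul P).
Proof. by move=> [[i s] l] [[j t] m] [[k u] n] /=; rewrite !mulgA. Qed.

Section Instances.
Variable P : Lam -> I -> G.
HB.instance Definition _ := gen_eqMixin (rees P).
HB.instance Definition _ := gen_choiceMixin (rees P).
HB.instance Definition _ := isSemigroup.Build (rees P) (@rees_mulA P).
End Instances.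

End Rees.

(* Main.v *)
Require Import Defs.

(** Forward direction. The subgroup H contains [G,G], so G/H is abelian, and
    it contains the entries of P, so (i, s, l) |-> s is multiplicative modulo H.
    Any map that is multiplicative modulo such a subgroup extends to S^1
    ([mod_morph_ext]), and reordering the factors of a product in S^1 does not
    change the value of the extension modulo H ([sim_s_cong]).

    Backward direction. Let row l0 and column i0 of P consist of ones. In a
    product only the first coordinate in I and the last one in Lam survive, and
    factors can be chosen so that the only entries of P that are met are 1; hence
    (i, s, l) ~ (i0, s, l0) ([sim_s_corner]) and only the group coordinate
    matters. The elements h such that (i0, hs, l0) ~ (i0, s, l0) for all s form
    a subgroup of G ([mod_stab_group]). It contains the entries of P, because
    (i0, 1, l) and (i, s, l0) have product (i0, p_{li} s, l0) in one order and
    (i, s, l) in the other ([sim_s_entry]). It contains the commutators, because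
    s |-> (i0, s, l0) is a morphism ([sim_s_comm]). Hence it contains H. *)

Set Implicit Arguments.
Unset Strict Implicit.
Unset Printing Implicit Defensive.

Local Open Scope classical_set_scope.
Local Open Scope group_scope.

(** * Generated subgroups *)

Section SubgroupClosure.
Variables (G : groupType) (K : set G).
Hypothesis KG : group_closed [in K].

Lemma group_set1 : K 1.
Proof. by case: KG => + _; rewrite inE. Qed.

Lemma group_setV x : K x -> K x^-1.
Proof. by move=> Kx; rewrite -inE; apply: (group_closedV KG); rewrite inE. Qed.

Lemma group_setM x y : K x -> K y -> K (x * y).
Proof.
by move=> Kx Ky; rewrite -inE; apply: (group_closedM KG); rewrite inE.
Qed.

End SubgroupClosure.

Lemma group_closed_set (G : groupType) (K : set G) :
  K 1 -> (forall x y, K x -> K y -> K (x * y^-1)) -> group_closed [in K].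
Proof.
move=> K1 KB; split; first by rewrite inE.
by move=> x y; rewrite !inE; apply: KB.
Qed.

Lemma gen_subgroup_group (G : groupType) (A : set G) :
  group_closed [in gen_subgroup A].
Proof.
apply: group_closed_set => [|x y Ax Ay] K [KG AK]; first exact: group_set1.
apply: group_setM => //; first exact: Ax.
by apply: group_setV => //; apply: Ay.
Qed.

(** * Congruence modulo a subgroup with abelian quotient *)

Definition cong_mod (G : groupType) (K : set G) (x y : G) : Prop :=
  K (x * y^-1).

Section AbelianQuotient.
Variables (G : groupType) (K : set G).
Hypothesis KG : group_closed [in K].
Hypothesis Kcomm : forall x y, K [~ x, y].

Local Notation cong := (cong_mod K).

Lemma mulgC_mem x y : K (x * y) -> K (y * x).
Proof. by move=> Kxy; rewrite commgC; apply: group_setM. Qed.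

Lemma cong_refl x : cong x x.
Proof. by rewrite /cong_mod mulgV; apply: group_set1. Qed.

Lemma cong_sym x y : cong x y -> cong y x.
Proof. by move=> /(group_setV KG); rewrite /cong_mod invgM invgK. Qed.

Lemma cong_trans y x z : cong x y -> cong y z -> cong x z.
Proof. by move=> xy /(group_setM KG xy); rewrite /cong_mod mulgA mulgVK. Qed.

Lemma cong_mul x y x' y' : cong x y -> cong x' y' -> cong (x * x') (y * y').
Proof.
move=> /mulgC_mem xy x'y'; rewrite /cong_mod invgM mulgA; apply: mulgC_mem.
by have := group_setM KG xy x'y'; rewrite !mulgA.
Qed.

Lemma cong_mulC x y : cong (x * y) (y * x).
Proof.
rewrite /cong_mod; apply: mulgC_mem.
by have := Kcomm x y; rewrite commgEl conjgE invgM !mulgA.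
Qed.

(** Working with congruences in G avoids forming the quotient group; each factor
    is moved to the front past the others by [cong_mulC]. *)
Lemma cong_prod_perm (T : eqType) (F : T -> G) (r1 r2 : seq T) :
  perm_eq r1 r2 -> cong (\prod_(x <- r1) F x) (\prod_(x <- r2) F x).
Proof.
have prod_rem x r : x \in r ->
    cong (\prod_(y <- r) F y) (F x * \prod_(y <- rem x r) F y).
  elim: r => // y r IHr /=; case: eqVneq => [->|y_x] rx.
    by rewrite big_cons; apply: cong_refl.
  have {IHr}/IHr rE : x \in r by move: rx; rewrite inE eq_sym (negPf y_x).
  rewrite !big_cons; apply: cong_trans (cong_mul (cong_refl _) rE) _.
  by rewrite !mulgA; apply: cong_mul (cong_mulC _ _) (cong_refl _).
elim: r1 r2 => [|x r1 IHr1] r2.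
  by rewrite perm_sym => /perm_nilP->; apply: cong_refl.
move=> r12; have r2x : x \in r2 by rewrite -(perm_mem r12) mem_head.
rewrite big_cons; apply: cong_trans (cong_sym (prod_rem _ _ r2x)).
apply: cong_mul (cong_refl _) (IHr1 _ _).
by rewrite -(perm_cons x) (perm_trans r12) ?perm_to_rem.
Qed.

(** * Similarity preserves multiplicative maps to an abelian quotient *)

Section ModularMorphism.
Variables (S : semigroupType) (v : S -> G).
Hypothesis vM : forall x y, cong (v (x * y)) (v x * v y).

(** If S has an identity e, then v e is congruent to its own square, hence to 1;
    otherwise the adjoined element is sent to 1. *)
Lemma mod_morph_ext : exists w : S1 S -> G,
  [/\ cong (w 1) 1, forall x y, cong (w (x * y)) (w x * w y)
    & forall x, w (toS1 x) = v x].
Proof.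
rewrite /toS1 /S1; case: pselect => [h|_].
  exists v; split => //; apply: cong_sym.
  have := vM (1 : monoid_with h) (1 : monoid_with h).
  have -> : ((1 : monoid_with h) : S) * ((1 : monoid_with h) : S)
              = (1 : monoid_with h) by exact: (mul1g (1 : monoid_with h)).
  by rewrite /cong_mod mul1g invgM mulgA mulgV mul1g.
exists (fun x => if x is Some a then v a else 1).
split => //; first exact: cong_refl.
case=> [x|] [y|] //=.
- by rewrite mulg1; apply: cong_refl.
- by rewrite mul1g; apply: cong_refl.
- by rewrite mul1g; apply: cong_refl.
Qed.

Lemma sim_s_cong x y : sim_s x y -> cong (v x) (v y).
Proof.
elim=> {x y} [x y|x y z _ xy _ yz]; last exact: cong_trans xy yz.
case=> n [p [f [_ xE yE]]]; have [w [w1 wM wE]] := mod_morph_ext.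
have w_prod (q : 'I_n -> S1 S) : cong (w (\prod_k q k)) (\prod_k w (q k)).
  apply: (big_ind2 (fun a b => cong (w a) b)) => // [a a' b b' aa' bb'|k _].
    by apply: cong_trans (wM _ _) _; apply: cong_mul.
  exact: cong_refl.
rewrite -!wE xE yE; apply: cong_trans (w_prod _) _.
apply: cong_trans (cong_sym (w_prod _)).
rewrite -(big_map f xpredT (fun k => w (p k))); apply: cong_prod_perm.
apply: uniq_perm; rewrite ?index_enum_uniq ?map_inj_uniq ?index_enum_uniq //.
  exact: perm_inj.
move=> k; rewrite mem_index_enum; apply/esym/mapP.
by exists (f^-1 k); rewrite ?mem_index_enum ?permKV.
Qed.

End ModularMorphism.
End AbelianQuotient.

(** * Elementary similarities *)

Section Similarity.
Variable S : semigroupType.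
Implicit Types x y z : S.

Lemma toS1M x y : toS1 (x * y) = toS1 x * toS1 y.
Proof. by rewrite /toS1 /S1; case: pselect. Qed.

Lemma sim_s_trans y x z : sim_s x y -> sim_s y z -> sim_s x z.
Proof. exact: t_trans. Qed.

Lemma sim_s_sym x y : sim_s x y -> sim_s y x.
Proof.
elim=> {x y} [x y|x y z _ yx _ zy]; last exact: sim_s_trans zy yx.
case=> n [p [f [n_gt0 xE yE]]]; apply: t_step.
exists n, (p \o f), f^-1; split => //.
by rewrite xE; apply: eq_bigr => k _ /=; rewrite permKV.
Qed.

(** Taking a in S^1 covers a swap with or without a left factor. *)
Lemma sim_s_swap1 (a : S1 S) (b c : S1 S) x y :
  toS1 x = a * (b * c) -> toS1 y = a * (c * b) -> sim_s x y.
Proof.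
move=> xE yE; apply: t_step.
pose p := tnth [tuple a; b; c].
pose i1 : 'I_3 := lift ord0 ord0; pose i2 : 'I_3 := lift ord0 (lift ord0 ord0).
exists 3, p, (tperm i1 i2); split => //.
  by rewrite xE !big_ord_recl big_ord0 /p !(tnth_nth a) /= mulg1.
rewrite yE !big_ord_recl big_ord0 tpermD // tpermL tpermR.
by rewrite /p !(tnth_nth a) /= mulg1.
Qed.

Lemma sim_s_mulC x y : sim_s (x * y) (y * x).
Proof.
by apply: (@sim_s_swap1 1 (toS1 x) (toS1 y)); rewrite toS1M mul1g.
Qed.

Lemma sim_s_swap x y z : sim_s (x * (y * z)) (x * (z * y)).
Proof.
by apply: (@sim_s_swap1 (toS1 x) (toS1 y) (toS1 z)); rewrite !toS1M.
Qed.

Lemma sim_s_refl x : sim_s x x.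
Proof.
apply: t_step; exists 1%N, (fun=> toS1 x), 1.
by rewrite !big_ord_recl !big_ord0 mulg1.
Qed.

End Similarity.

(** * Similarity in a normalized Rees matrix semigroup *)

Section NormalizedRees.
Variables (G : groupType) (I Lam : Type) (P : Lam -> I -> G).
Variables (l0 : Lam) (i0 : I).
Hypothesis row1 : forall i, P l0 i = 1.
Hypothesis col1 : forall l, P l i0 = 1.

Local Notation elt i s l := ((i, s, l) : rees P).
Local Notation corner s := (elt i0 s l0).

Lemma reesM i s l j t m : elt i s l * elt j t m = elt i (s * P l j * t) m.
Proof. by []. Qed.

(** A factor (i0, 1, n) on the right only sets the last coordinate to n; moved
    inwards, it no longer affects that coordinate. A factor (i0, 1, l0) has no
    effect on the right of (k, r, l0); moved to the left, it sets the first
    coordinate to i0. *)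
Lemma sim_s_corner i s l : sim_s (elt i s l) (corner s).
Proof.
have to_l0 k r n : sim_s (elt k r n) (elt k r l0).
  have := sim_s_swap (elt k 1 l0) (corner r) (elt i0 1 n).
  by rewrite !reesM !row1 !col1 !mul1g !mulg1.
have to_i0 k r : sim_s (elt k r l0) (corner r).
  have := sim_s_mulC (elt k r l0) (corner 1).
  by rewrite !reesM !row1 !mul1g !mulg1.
exact: sim_s_trans (to_l0 _ _ _) (to_i0 _ _).
Qed.

(** The factors (i0, 1, l) and (i, s, l0) meet at P l i in this order, and at
    P l0 i0 = 1 in the other. *)
Lemma sim_s_entry i s l : sim_s (corner (P l i * s)) (corner s).
Proof.
have := sim_s_mulC (elt i0 1 l) (elt i s l0).
rewrite !reesM row1 mul1g !mulg1 => ps_s.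
exact: sim_s_trans ps_s (sim_s_corner _ _ _).
Qed.

Lemma corner_swap a b c : sim_s (corner (a * (b * c))) (corner (a * (c * b))).
Proof.
have := sim_s_swap (corner a) (corner b) (corner c).
by rewrite !reesM !row1 !mulg1.
Qed.

(** Write [x, y] s as x^-1 y^-1 (x y s): swapping the last two factors leaves
    y s y^-1, and one more swap removes y. *)
Lemma sim_s_comm x y s : sim_s (corner ([~ x, y] * s)) (corner s).
Proof.
have -> : [~ x, y] * s = x^-1 * (y^-1 * (x * (y * s))).
  by rewrite commgEl conjgE !mulgA.
apply: sim_s_trans (corner_swap _ _ _) _; rewrite -!mulgA mulKg.
have := corner_swap 1 y (s * y^-1).
by rewrite !mul1g mulgVK.
Qed.

(** The condition ranges over all s, rather than s = 1 only, so that the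
    similarities for two elements can be chained. *)
Definition mod_stab : set G :=
  [set h | forall s, sim_s (corner (h * s)) (corner s)].

Lemma mod_stab_group : group_closed [in mod_stab].
Proof.
apply: group_closed_set => [s|x y xK yK s].
  by rewrite mul1g; apply: sim_s_refl.
rewrite -mulgA; apply: sim_s_trans (xK _) _; apply: sim_s_sym.
by have := yK (y^-1 * s); rewrite mulKVg.
Qed.

Lemma gen_sub_mod_stab :
  gen_subgroup (commutator_subgroup G `|` entries P) `<=` mod_stab.
Proof.
apply: smallest_sub; first exact: mod_stab_group.
rewrite subUset; split.
  apply: smallest_sub; first exact: mod_stab_group.
  by move=> _ [x _ [y _ <-]] s; apply: sim_s_comm.
by move=> _ [l _ [i _ <-]] s; apply: sim_s_entry.
Qed.

End NormalizedRees.

Theorem corollary23 (G : groupType) (I Lam : Type)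
    (I_nonempty : inhabited I) (Lam_nonempty : inhabited Lam)
    (P : Lam -> I -> G) (P_normalized : normalized P)
    (i : I) (s : G) (l : Lam) (j : I) (t : G) (m : Lam) :
  sim_s ((i, s, l) : rees P) ((j, t, m) : rees P) <->
  gen_subgroup (commutator_subgroup G `|` entries P) (s * t^-1).
Proof.
set H := gen_subgroup _; have HG : group_closed [in H] := gen_subgroup_group _.
have Hcomm x y : H [~ x, y].
  apply: sub_gen_smallest; left; apply: sub_gen_smallest.
  by exists x => //; exists y.
have [[l0 row1] [i0 col1]] := P_normalized.
split=> [|Hst].
  apply: (sim_s_cong HG Hcomm (v := fun x : rees P => x.1.2)).
  move=> [[i1 s1] l1] [[i2 s2] l2] /=.
  apply: (cong_mul HG Hcomm) (cong_refl HG _); rewrite /cong_mod.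
  apply: (mulgC_mem HG Hcomm); rewrite mulKg.
  by apply: sub_gen_smallest; right; exists l1 => //; exists i2.
have := gen_sub_mod_stab row1 col1 Hst t; rewrite mulgVK => st.
apply: sim_s_trans (sim_s_corner row1 col1 _ _ _) _.
by apply: sim_s_trans st _; apply: sim_s_sym; apply: sim_s_corner.
Qed.
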